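(* Let $m\ge1$ be odd, $G=(\mathbb{Z}/2\mathbb{Z})^m$, and $d=2^m$. Let $\zeta\in\mathbb{F}_{3^2}$ be a primitive element, and define $\varphi\in\mathbb{F}_{3^2}^G$ by $\varphi(x)=-1-\zeta^2$ if $x=0$ and $\varphi(x)=1$ otherwise. Then $\Phi=\{T_xM_y\varphi\}_{x,y\in G}$ is a $(0,1,0)$-ETF in $\mathbb{F}_{3^2}^G$. In particular, Gerzon's bound is attained in a unitary space over $\mathbb{F}_{3^2}$ whenever its dimension $d$ is twice a power of $4$; that is, such a space contains an $(a,b)$-equiangular system of $d^2$ vectors with $a^2\neq b$.
   Context: $\mathbb{F}_{3^2}^G$ is the space of functions $G\to\mathbb{F}_{3^2}$ with Hermitian form $\langle\varphi,\psi\rangle=\sum_{x\in G}\varphi(x)^3\psi(x)$. For $x,y\in G$ put $\hat y(x)=(-1)^{x_1y_1+\dots+x_my_m}$; the modulation and translation operators are $(M_y\varphi)(x)=\hat y(x)\varphi(x)$ and $(T_y\varphi)(x)=\varphi(x-y)$. A unitary space over $\mathbb{F}_{3^2}$ is a finite-dimensional $\mathbb{F}_{3^2}$-vector space with a nondegenerate form $\langle\cdot,\cdot\rangle$ that is linear in the second variable and satisfies $\langle u,v\rangle=\langle v,u\rangle^3$. In such a space $V$, and for $a,b,c\in\mathbb{F}_3$, a finite family $\{\varphi_j\}_{j\in J}$ is an $(a,b)$-equiangular system if $\langle\varphi_j,\varphi_j\rangle=a$ for all $j$ and $\langle\varphi_i,\varphi_j\rangle\langle\varphi_j,\varphi_i\rangle=b$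 for all $i\neq j$; it is an $(a,b,c)$-ETF if moreover it spans $V$ and $\sum_{j\in J}\langle\varphi_j,v\rangle\varphi_j=cv$ for all $v\in V$. Gerzon's bound says that an $(a,b)$-equiangular system with $a^2\neq b$ in a $d$-dimensional unitary space has at most $d^2$ vectors. *)

(* Defs.v *)
From HB Require Import structures.
From mathcomp Require Import all_boot all_order all_algebra.

Set Implicit Arguments.
Unset Strict Implicit.
Unset Printing Implicit Defensive.

Import GRing.Theory.
Local Open Scope ring_scope.

(* Here F is meant to be the field with 9 elements, so that v ^+ 3 is its
   conjugation.  The library's sesquilinear forms are linear in the first
   variable; the forms here are linear in the second one. *)
Record unitary_form (F : finFieldType) (V : vectType F) (form : V -> V -> F) :
    Prop := UnitaryForm {
  unitary_linear : forall u, scalar (form u);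
  unitary_conj : forall u v, form u v = form v u ^+ 3;
  unitary_nondegenerate : forall u, (forall v, form u v = 0) -> u = 0
}.

(* Elements of 'F_3 are ordinals below 3; if F has characteristic 3, this is
   the embedding of the prime field. *)
Definition of_F3 (F : finFieldType) (a : 'F_3) : F := (a : nat)%:R.

Definition equiangular (F : finFieldType) (V : vectType F)
    (form : V -> V -> F) (a b : 'F_3) (J : finType) (Phi : J -> V) : Prop :=
  (forall j, form (Phi j) (Phi j) = of_F3 F a) /\
  (forall i j, i <> j ->
     form (Phi i) (Phi j) * form (Phi j) (Phi i) = of_F3 F b).

Definition ETF (F : finFieldType) (V : vectType F)
    (form : V -> V -> F) (a b c : 'F_3) (J : finType) (Phi : J -> V) : Prop :=
  [/\ equiangular form a b Phi,
      <<codom Phi>>%VS = fullv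
    & forall v, \sum_(j : J) form (Phi j) v *: Phi j = of_F3 F c *: v].

Notation grp m := 'rV['Z_2]_m.

Notation fspace F m := {ffun grp m -> F^o}.

Definition fun_form (F : finFieldType) (m : nat) (phi psi : fspace F m) : F :=
  \sum_(x : grp m) (phi x : F) ^+ 3 * psi x.

(* The coordinates are taken in {0, 1}; only the parity of the exponent
   matters. *)
Definition chi (F : finFieldType) (m : nat) (y x : grp m) : F :=
  (-1) ^+ (\sum_(i < m) (x 0%R i : nat) * (y 0%R i : nat))%N.

Definition modulation (F : finFieldType) (m : nat) (y : grp m)
    (phi : fspace F m) : fspace F m :=
  [ffun x => chi F y x * phi x].

Definition translation (F : finFieldType) (m : nat) (y : grp m)
    (phi : fspace F m) : fspace F m :=
  [ffun x => phi (x - y)].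

Definition fiducial (F : finFieldType) (m : nat) (zeta : F) : fspace F m :=
  [ffun x => if x == 0 then - 1 - zeta ^+ 2 else 1].

Definition gabor (F : finFieldType) (m : nat) (phi : fspace F m)
    (p : grp m * grp m) : fspace F m :=
  translation p.1 (modulation p.2 phi).

(* Main.v *)
Require Import Defs.
From mathcomp Require Import all_boot all_order all_algebra.
From mathcomp Require Import all_solvable all_field ring.

Import GRing.Theory.
Local Open Scope ring_scope.

(** Since [3 = 0], the fiducial vector is [1 + w delta_0] with
    [w = 1 - zeta ^+ 2], where [zeta ^+ 2] is a square root of [-1]; hence [w]
    has trace [-1] and norm [-1], and [d = 2 ^ m = -1] because [m] is odd.
    Expanding the product, the inner product of the vectors indexed by [(x, y)]
    and [(x', y')] is
    [chi_y(x) chi_y'(x') d [y = y'] + w^3 chi_y'(x - x') + w chi_y(x - x')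
     + w^4 [x = x']],
    which has norm 1 off the diagonal and vanishes on it.  By orthogonality of
    characters the frame operator of any Gabor system is multiplication by
    [d <phi, phi>], which is 0 here.

    A unitary space of dimension [d] contains [d] orthonormal vectors: the
    orthogonal of a shorter orthonormal family contains a non-isotropic vector,
    whose norm is [1] or [-1], and scaling by [zeta] exchanges these since
    [zeta ^+ 4 = -1].  So the function space embeds isometrically. *)

(** * Characters of the group and their orthogonality *)

Section Characters.

Variable F : finFieldType.
Variable m : nat.
Implicit Types x y z : grp m.

Lemma Z2_opp (a : 'Z_2) : - a = a.
Proof. by apply/val_inj; case: a => [[|[|]]]. Qed.

Lemma grp_opp x : - x = x.
Proof. by apply/matrixP=> i j; rewrite mxE Z2_opp. Qed.

Lemma grp_subC x y : x - y = y - x.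
Proof. by rewrite -[LHS]grp_opp opprB. Qed.

Lemma card_grp : #|{: grp m}| = (2 ^ m)%N.
Proof. by rewrite card_mx card_ord mul1n. Qed.

Lemma chiE y x : chi F y x = \prod_(i < m) (-1) ^+ ((x 0 i : nat) * (y 0 i : nat)).
Proof. by rewrite /chi expr_sum. Qed.

Lemma chiC y x : chi F y x = chi F x y.
Proof. by rewrite !chiE; apply: eq_bigr => i _; rewrite mulnC. Qed.

Lemma chi0r y : chi F y 0 = 1.
Proof. by rewrite chiE big1 // => i _; rewrite mxE mul0n. Qed.

Lemma chiD y x z : chi F y (x + z) = chi F y x * chi F y z.
Proof.
rewrite !chiE -big_split; apply: eq_bigr => i _ /=.
rewrite mxE; move: (x 0 i) (z 0 i) (y 0 i).
move=> [[|[|]] // ?] [[|[|]] // ?] [[|[|]] // ?];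
  by rewrite /= ?muln0 ?mul0n ?muln1 ?expr0 ?expr1 ?mulr1 ?mul1r ?mulrNN ?mulr1.
Qed.

Lemma chi_sqr y x : chi F y x * chi F y x = 1.
Proof. by rewrite /chi -expr2 sqrr_sign. Qed.

Lemma chi_cube y x : chi F y x ^+ 3 = chi F y x.
Proof. by rewrite exprS expr2 chi_sqr mulr1. Qed.

Lemma chiB y x z : chi F y (x - z) = chi F y x * chi F y z.
Proof. by rewrite grp_opp chiD. Qed.

Hypothesis F2 : 2%:R != 0 :> F.

(** For nonzero [x], translating [y] by a basis vector [e] on which [chi F x] is -1 turns the sum
    into its own opposite, and 2 is invertible. *)
Lemma sum_chi x : \sum_y chi F y x = if x == 0 then (2 ^ m)%:R else 0.
Proof.
case: eqVneq => [-> | x0].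
  under eq_bigr do rewrite chi0r.
  by rewrite sumr_const card_grp.
have [i xi] : exists i, x 0 i != 0.
  apply/existsP; apply: contraNT x0; rewrite negb_exists => /forallP x0.
  by apply/eqP/rowP => i; rewrite mxE; apply/eqP; have := x0 i; rewrite negbK.
pose e : grp m := delta_mx 0 i.
have chi_e : chi F x e = -1.
  rewrite chiE (bigD1 i) //= big1 => [|j ji]; last first.
    by rewrite mxE eqxx (negPf ji) mul0n.
  rewrite mxE !eqxx mulr1; move: (x 0 i) xi.
  by move=> [[|[|]] // ?] _; rewrite /= muln1 expr1.
set S := \sum_y _.
have SN : S = - S.
  rewrite {1}/S (reindex_inj (addIr e)) /= -sumrN; apply: eq_bigr => y _.
  by rewrite chiC chiD chi_e mulrN1 chiC.
apply/eqP; have /eqP : S + S = 0 by rewrite {1}SN addNr.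
by rewrite -mulr2n -mulr_natr mulf_eq0 (negPf F2) orbF.
Qed.

Lemma sum_chi_mul y z :
  \sum_x chi F y x * chi F z x = if y == z then (2 ^ m)%:R else 0.
Proof.
rewrite -subr_eq0 -sum_chi; apply: eq_bigr => x _.
by rewrite (chiC y) (chiC z) -chiB.
Qed.

End Characters.

(** * Arithmetic in the field of nine elements *)

Section FieldOfOrder9.

Variable F : finFieldType.
Hypothesis hF : #|F| = (3 ^ 2)%N.

Lemma pchar3 : 3%N \in [pchar F].
Proof. exact: (card_finPcharP hF). Qed.

Lemma nat3_eq0 : 3%:R = 0 :> F.
Proof. exact: pcharf0 pchar3. Qed.

Lemma natN1 : 2%:R = -1 :> F.
Proof. by apply/eqP; rewrite -subr_eq0 opprK natr1 nat3_eq0. Qed.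

Lemma nat2_neq0 : 2%:R != 0 :> F.
Proof. by rewrite natN1 oppr_eq0 oner_eq0. Qed.

Lemma cubeD (x y : F) : (x + y) ^+ 3 = x ^+ 3 + y ^+ 3.
Proof. by rewrite -!(pFrobenius_autE pchar3) rmorphD. Qed.

Lemma cube_sum (I : finType) (f : I -> F) :
  (\sum_i f i) ^+ 3 = \sum_i f i ^+ 3.
Proof.
rewrite -(pFrobenius_autE pchar3) rmorph_sum /=.
by apply: eq_bigr => i _; rewrite -(pFrobenius_autE pchar3).
Qed.

Lemma cubeK (x : F) : (x ^+ 3) ^+ 3 = x.
Proof. by rewrite -exprM -[RHS]expf_card hF. Qed.

(** All [#|F|.-1] nonzero elements are roots of unity of that order. This supplies a [zeta] where
    none is given: for rescaling vectors of norm -1 and for the claim about Gerzon's bound. *)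
Lemma prim_root_exists : exists zeta : F, (#|F|.-1).-primitive_root zeta.
Proof.
have n0 : (0 < #|F|.-1)%N by rewrite hF.
pose rs := enum (predC1 (0 : F)).
have rsP : all (#|F|.-1).-unity_root rs.
  apply/allP => x; rewrite mem_enum inE => x0.
  apply/unity_rootP; apply: (mulfI x0).
  by rewrite -exprS mulr1 prednK ?expf_card // hF.
have /hasP [z _ zP] : has (#|F|.-1).-primitive_root rs.
  apply: has_prim_root n0 rsP (enum_uniq _) _.
  by rewrite -cardE cardC1.
by exists z.
Qed.

End FieldOfOrder9.

(** * Gabor systems in the function space, and the inner products for the fiducial vector *)

Section FunctionSpace.

Variable F : finFieldType.
Hypothesis hF : #|F| = (3 ^ 2)%N.
Variable m : nat.
Implicit Types (phi psi : fspace F m) (p q : grp m * grp m).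

Lemma sum_delta (f : grp m -> F) x : \sum_z f z * (z == x)%:R = f x.
Proof.
rewrite (bigD1 x) //= eqxx mulr1 big1 ?addr0 // => z /negPf ->.
by rewrite mulr0.
Qed.

Lemma fun_form_unitary : unitary_form (V := fspace F m) (@fun_form F m).
Proof.
split=> [u a v w | u v | u u0].
- rewrite /fun_form mulr_sumr -big_split; apply: eq_bigr => x _ /=.
  by rewrite !ffunE /= mulrDr mulrCA.
- rewrite /fun_form (cube_sum F hF); apply: eq_bigr => x _.
  by rewrite exprMn (cubeK F hF) mulrC.
- apply/ffunP => x; rewrite ffunE.
  have := u0 [ffun z => (z == x)%:R].
  rewrite /fun_form; under eq_bigr do rewrite ffunE.
  by rewrite sum_delta => /eqP; rewrite expf_eq0 => /eqP.
Qed.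

Lemma gaborE phi p z : gabor phi p z = chi F p.2 (z - p.1) * phi (z - p.1).
Proof. by rewrite !ffunE. Qed.

Lemma gabor_frame phi v :
  \sum_p fun_form (gabor phi p) v *: gabor phi p
    = (2 ^ m)%:R * fun_form phi phi *: v.
Proof.
apply/ffunP => z; rewrite sum_ffunE ffunE.
transitivity (\sum_x \sum_u \sum_y
    phi (u - x) ^+ 3 * v u * phi (z - x) * (chi F y (u - x) * chi F y (z - x)) : F).
  rewrite -(pair_bigA _
    (fun x y => (fun_form (gabor phi (x, y)) v *: gabor phi (x, y)) z)) /=.
  apply: eq_bigr => x _; rewrite exchange_big; apply: eq_bigr => y _.
  rewrite ffunE /fun_form /= [_ *: _]mulr_suml; apply: eq_bigr => u _.
  rewrite !gaborE /= exprMn chi_cube.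
  have ring_eq (a b c d e : F) : a * b * c * (d * e) = b * c * e * (a * d) by ring.
  exact: ring_eq.
(* Summing over [y] first, orthogonality of characters leaves only the terms with [u = z]. *)
transitivity ((2 ^ m)%:R * (\sum_x phi (z - x) ^+ 3 * phi (z - x)) * v z : F).
  rewrite mulr_sumr mulr_suml; apply: eq_bigr => x _.
  rewrite -[RHS](sum_delta
    (fun u => (2 ^ m)%:R * (phi (u - x) ^+ 3 * phi (z - x)) * v u)).
  apply: eq_bigr => u _.
  rewrite -mulr_sumr; under eq_bigr do rewrite chiC (chiC _ _ _ (z - x)).
  rewrite (sum_chi_mul _ _ (nat2_neq0 F hF)) (inj_eq (addIr _)).
  have ring_eq (a b c d : F) (e : bool) : a * b * c * (if e then d else 0)
    = d * (a * c) * b * e%:R by case: e => /=; ring.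
  exact: ring_eq.
by rewrite /fun_form [in RHS](reindex_inj (subrI z)).
Qed.

(** The frame constant may be 0, so the frame identity does not give spanning. Instead, summing the
    vectors indexed by [(x, y)] over [y] isolates the indicator of [x], up to the factor
    [(2 ^ m)%:R * phi 0]. *)
Lemma gabor_span phi : phi 0 != 0 -> <<codom (gabor phi)>>%VS = fullv.
Proof.
move=> phi0; apply/eqP; rewrite eqEsubv subvf /=; apply/subvP => v _.
pose e x : fspace F m := [ffun z => (z == x)%:R].
have d0 : (2 ^ m)%:R * phi 0 != 0 :> F.
  by rewrite mulf_neq0 // natrX expf_neq0 // (nat2_neq0 F hF).
have eE x : e x = ((2 ^ m)%:R * phi 0)^-1 *: \sum_y gabor phi (x, y).
  apply/ffunP => z; rewrite ffunE ffunE sum_ffunE.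
  under eq_bigr do rewrite gaborE /=.
  rewrite -mulr_suml (sum_chi _ _ (nat2_neq0 F hF)) subr_eq0.
  case: eqVneq => [-> | _]; last by rewrite mul0r scaler0.
  by rewrite subrr; apply/esym; apply: mulVf.
have -> : v = \sum_x (v x : F) *: e x.
  apply/ffunP => z; rewrite sum_ffunE -[LHS]sum_delta.
  by apply: eq_bigr => x _; rewrite !ffunE eq_sym.
apply: rpred_sum => x _; rewrite eE; do 2!apply: rpredZ.
by apply: rpred_sum => y _; apply/memv_span/codom_f.
Qed.

Variable zeta : F.
Hypothesis zeta_prim : (#|F|.-1).-primitive_root zeta.
Let w := 1 - zeta ^+ 2.

Lemma zeta4 : zeta ^+ 4 = -1.
Proof.
have := zeta_prim; rewrite hF => z8.
have /eqP : (zeta ^+ 4) ^+ 2 = 1 by rewrite -exprM (prim_expr_order z8).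
rewrite sqrf_eq1 => /orP[|/eqP //].
by rewrite -(prim_order_dvd z8).
Qed.

Lemma trace_w : w ^+ 3 + w = -1.
Proof.
have [z4 n3] := (zeta4, nat3_eq0 F hF).
rewrite /w.
(* An identity over the integers, whose last two terms vanish by 3 = 0 and [zeta ^+ 4 = -1]. *)
transitivity (-1 + 3%:R * (1 - zeta ^+ 2 + zeta ^+ 4) - zeta ^+ 2 * (1 + zeta ^+ 4) : F).
  by ring.
by rewrite n3 z4; ring.
Qed.

Lemma norm_w : w ^+ 3 * w = -1.
Proof.
have [z4 n3] := (zeta4, nat3_eq0 F hF).
transitivity (-1 + 3%:R * (-1) : F); last by rewrite n3; ring.
rewrite /w.
have -> : (1 - zeta ^+ 2) ^+ 3 * (1 - zeta ^+ 2)
  = 1 - 4%:R * zeta ^+ 2 + 6%:R * zeta ^+ 4 - 4%:R * zeta ^+ 2 * zeta ^+ 4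
    + zeta ^+ 4 * zeta ^+ 4 by ring.
by rewrite z4; ring.
Qed.

Lemma fiducialE z x : fiducial m zeta (z - x) = 1 + w * (z == x)%:R.
Proof.
rewrite ffunE subr_eq0; case: eqP => _; last by rewrite mulr0 addr0.
rewrite /w mulr1 -[LHS]addr0 -(nat3_eq0 F hF); ring.
Qed.

Lemma gabor_form p q :
  fun_form (gabor (fiducial m zeta) p) (gabor (fiducial m zeta) q)
  = chi F p.2 p.1 * chi F q.2 q.1 * (if p.2 == q.2 then (2 ^ m)%:R else 0)
    + w ^+ 3 * chi F q.2 (p.1 - q.1) + w * chi F p.2 (p.1 - q.1)
    + (if p.1 == q.1 then w ^+ 3 * w else 0).
Proof.
case: p q => [x y] [x' y'] /=.
(* The factor common to the four terms of the expanded product; each Kronecker delta then evaluates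
   [f] at [x] or [x']. *)
pose f z := chi F y (z - x) * chi F y' (z - x').
transitivity (\sum_z (f z + w ^+ 3 * f z * (z == x)%:R + w * f z * (z == x')%:R
   + w ^+ 3 * w * f z * (z == x')%:R * (z == x)%:R)).
  apply: eq_bigr => z _; rewrite !gaborE !fiducialE /= exprMn chi_cube.
  rewrite (cubeD F hF) expr1n exprMn -natrX.
  have -> : ((z == x) ^ 3 = (z == x))%N by case: (z == x).
  by rewrite /f; ring.
rewrite !big_split /= !sum_delta; congr (_ + _ + _ + _).
- rewrite -(sum_chi_mul _ _ (nat2_neq0 F hF)) mulr_sumr.
  by apply: eq_bigr => z _; rewrite /f !chiB; ring.
- by rewrite /f subrr chi0r mul1r.
- by rewrite /f subrr chi0r mulr1 grp_subC.
- rewrite /f; case: eqVneq => [-> | _]; last by rewrite mulr0.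
  by rewrite subrr !chi0r !mulr1.
Qed.

End FunctionSpace.

(** * The Gabor system of the fiducial vector as an ETF *)

Section GaborSystem.

Variable F : finFieldType.
Hypothesis hF : #|F| = (3 ^ 2)%N.
Variables (m : nat) (zeta : F).
Hypotheses (m_odd : odd m) (zeta_prim : (#|F|.-1).-primitive_root zeta).

Lemma natr_card_grp : (2 ^ m)%:R = -1 :> F.
Proof. by rewrite natrX (natN1 F hF) -signr_odd m_odd. Qed.

Lemma fiducial_isotropic :
  fun_form (fiducial m zeta) (fiducial m zeta) = 0.
Proof.
have E : gabor (fiducial m zeta) (0, 0) = fiducial m zeta.
  by apply/ffunP => z; rewrite gaborE /= subr0 chiC chi0r mul1r.
(* The inner product is [d + (w ^+ 3 + w) + w ^+ 4], which is -1 - 1 - 1 = 0. *)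
rewrite -E (gabor_form F hF) //= !eqxx subrr !chi0r !mulr1 mul1r natr_card_grp.
rewrite -addrA -addrA [w in _ + w]addrA (trace_w F hF) // (norm_w F hF) //.
by rewrite -[RHS]oppr0 -(nat3_eq0 F hF); ring.
Qed.

Lemma gabor_isotropic p :
  fun_form (gabor (fiducial m zeta) p) (gabor (fiducial m zeta) p) = 0.
Proof.
rewrite -fiducial_isotropic /fun_form.
rewrite [RHS](reindex_inj (addIr (- p.1))); apply: eq_bigr => z _ /=.
rewrite gaborE exprMn chi_cube mulrACA.
by rewrite chi_sqr mul1r.
Qed.

Lemma gabor_equiangular :
  equiangular (V := fspace F m) (@fun_form F m) 0 1 (gabor (fiducial m zeta)).
Proof.
split=> [j | p q pq]; first exact: gabor_isotropic.
(* The product becomes [s * s ^+ 3] for the single inner product [s] of [p] and [q]. *)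
rewrite [X in _ * X](unitary_conj (fun_form_unitary F hF m)).
have n3 := nat3_eq0 F hF.
have [tr nm] := (trace_w F hF zeta zeta_prim, norm_w F hF zeta zeta_prim).
have -> : of_F3 F 1 = 1 by [].
rewrite (gabor_form F hF) // [in LHS]/=.
set w := 1 - zeta ^+ 2 in tr nm *.
case: p q pq => [x y] [x' y'] /= pq.
case: (eqVneq y y') pq => [<- | yy'] pq.
  (* Equal modulations: [s] is -2 = 1 times a sign. *)
  have /negPf -> : x != x' by apply: contra_notN pq => /eqP ->.
  have cE : chi F y x * chi F y x' = chi F y (x - x') by rewrite chiB.
  rewrite cE natr_card_grp addr0 mulrN1 -addrA -mulrDl tr.
  have -> : - chi F y (x - x') + -1 * chi F y (x - x') = chi F y (x - x').
    by rewrite -[RHS]subr0 -[0](mul0r (chi F y (x - x'))) -n3; ring.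
  by rewrite chi_cube chi_sqr.
rewrite mulr0 add0r; case: eqVneq => [<- | _].
  (* Equal translations, different modulations: [s] is -1 - 1 = 1. *)
  rewrite subrr !chi0r !mulr1 tr nm.
  have -> : -1 + -1 = 1 :> F by rewrite -[RHS]subr0 -n3; ring.
  by rewrite expr1n mulr1.
rewrite addr0; clearbody w.
rewrite (cubeD F hF) ![(_ * chi F _ _) ^+ 3]exprMn (cubeK F hF) !chi_cube.
have [aa bb] := (chi_sqr F m y' (x - x'), chi_sqr F m y (x - x')).
move: (chi F y' (x - x')) (chi F y (x - x')) aa bb => a b aa bb.
(* Both indices differ: [s = w ^+ 3 * a + w * b] with signs [a], [b]. The coefficient of [a * b] is
   trace squared minus twice the norm, 1 + 2 = 0, and the rest is -2 = 1. *)
transitivity (w ^+ 3 * w * (a * a + b * b)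
    + ((w ^+ 3 + w) ^+ 2 - 2%:R * (w ^+ 3 * w)) * (a * b)); first by ring.
rewrite aa bb tr nm.
by rewrite -[RHS]addr0 -[X in _ = _ + X](mul0r (a * b - 1)) -n3; ring.
Qed.

Lemma gabor_ETF :
  ETF (V := fspace F m) (@fun_form F m) 0 1 0 (gabor (fiducial m zeta)).
Proof.
split; first exact: gabor_equiangular.
- apply: (gabor_span F hF); rewrite ffunE eqxx.
  (* If the value at 0 vanished, then [zeta ^+ 2 = -1] and [zeta ^+ 4] would be 1. *)
  apply: contra_eq_neq (zeta4 F hF zeta zeta_prim) => /eqP.
  rewrite subr_eq0 => /eqP z2.
  by rewrite (exprM _ 2 2) -z2 sqrrN expr1n -subr_eq0 opprK nat2_neq0.
- by move=> v; rewrite (gabor_frame F hF) fiducial_isotropic mulr0.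
Qed.

End GaborSystem.

(** * Orthonormal families in a unitary space *)

Section OrthonormalFamily.

Variable F : finFieldType.
Hypothesis hF : #|F| = (3 ^ 2)%N.
Variables (V : vectType F) (form : V -> V -> F).
Hypothesis form_unitary : unitary_form form.

Lemma formDr u v w : form u (v + w) = form u v + form u w.
Proof. by have := unitary_linear form_unitary u 1 v w; rewrite scale1r mul1r. Qed.

Lemma form0r u : form u 0 = 0.
Proof. by apply: (addrI (form u 0)); rewrite -formDr !addr0. Qed.

Lemma formZr u a v : form u (a *: v) = a * form u v.
Proof.
by have := unitary_linear form_unitary u a v 0; rewrite !addr0 form0r addr0.
Qed.

Lemma form_sumr (I : Type) (r : seq I) u (f : I -> V) :
  form u (\sum_(i <- r) f i) = \sum_(i <- r) form u (f i).
Proof.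
exact: (big_morph (form u) (formDr u) (form0r u)).
Qed.

Lemma formBr u v w : form u (v - w) = form u v - form u w.
Proof. by rewrite formDr -scaleN1r formZr mulN1r. Qed.

Lemma formC u v : form u v = form v u ^+ 3.
Proof. exact: unitary_conj. Qed.

Lemma formDl u v w : form (u + v) w = form u w + form v w.
Proof. by rewrite formC formDr (cubeD F hF) -!formC. Qed.

Lemma formZl a u v : form (a *: u) v = a ^+ 3 * form u v.
Proof. by rewrite formC formZr exprMn -formC. Qed.

Lemma form_suml (I : finType) (f : I -> V) v :
  form (\sum_i f i) v = \sum_i form (f i) v.
Proof.
by rewrite formC form_sumr (cube_sum F hF); apply: eq_bigr => i _; rewrite -formC.
Qed.

Lemma form_neq0_witness u : u != 0 -> exists v, form u v != 0.
Proof.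
move=> u0; case: (boolP (has (fun v => form u v != 0) (vbasis {:V}))).
  by case/hasP => v _ uv; exists v.
move=> /hasPn uv0; case/eqP: u0.
apply: (unitary_nondegenerate form_unitary) => v.
rewrite (coord_vbasis (memvf v)) form_sumr big1 // => i _.
have /uv0 : (vbasis {:V})`_i \in vbasis {:V} by rewrite mem_nth ?size_tuple.
by rewrite formZr negbK => /eqP ->; rewrite mulr0.
Qed.

Section Extension.

Variables (n : nat) (e : nat -> V).
Hypothesis e_orthonormal :
  forall i j, (i < n)%N -> (j < n)%N -> form (e i) (e j) = (i == j)%:R.

Let proj v := \sum_(i < n) form (e i) v *: e i.

Lemma orth_proj v i : (i < n)%N -> form (e i) (v - proj v) = 0.
Proof.
move=> ni; rewrite formBr form_sumr (bigD1 (Ordinal ni)) //= formZr.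
rewrite e_orthonormal // eqxx mulr1 big1 ?addr0 ?subrr // => j ji.
rewrite formZr e_orthonormal // eq_sym -[i]/(val (Ordinal ni)) val_eqE.
by rewrite (negPf ji) mulr0.
Qed.

Let orth v := forall i, (i < n)%N -> form (e i) v = 0.

(* If the orthogonal vectors u and w are isotropic and c = <u,w> is nonzero,
   then u + c^-1 w is orthogonal and <u + c^-1 w, u + c^-1 w> = 1 + 1. *)
Lemma orth_anisotropic :
  (n < \dim {:V})%N -> exists2 u, orth u & form u u != 0.
Proof.
move=> nd.
have [u [w [ou ow c0]]] : exists u w, [/\ orth u, orth w & form u w != 0].
  (* A vector [x] of a linear complement of the span is corrected to the orthogonal [u], nonzero
     because [x] is outside the span. Nondegeneracy gives a partner [v], and removing its projection
     does not change its product with [u]. *)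
  pose U := <<[seq e i | i <- iota 0 n]>>%VS.
  have UC0 : (U^C)%VS != 0%VS.
    rewrite -dimv_eq0 dimv_compl -lt0n subn_gt0.
    by apply: leq_ltn_trans (dim_span _) _; rewrite size_map size_iota.
  pose x := vpick (U^C)%VS; pose u := x - proj x.
  have u0 : u != 0.
    rewrite subr_eq0; apply: contra_neqN UC0 => /eqP xE.
    apply/eqP; rewrite -vpick0 -memv0 -(capv_compl U) memv_cap memv_pick andbT.
    rewrite -/x xE; apply: rpred_sum => i _; apply/rpredZ/memv_span/map_f.
    by rewrite mem_iota /=.
  have [v uv] := form_neq0_witness u u0.
  have ou : orth u by move=> i; apply: orth_proj.
  exists u, (v - proj v); split=> // [i|]; first exact: orth_proj.
  rewrite formBr form_sumr big1 ?subr0 // => i _.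
  by rewrite formZr (formC u) ou ?ltn_ord // expr0n mulr0.
pose c := form u w.
have [uu | uu] := eqVneq (form u u) 0; last by exists u.
have [ww | ww] := eqVneq (form w w) 0; last by exists w.
exists (u + c^-1 *: w) => [i ni|]; first by rewrite formDr formZr ou // ow // mulr0 addr0.
rewrite formDr !formDl !formZr !formZl uu ww (formC w u) -/c add0r !mulr0 addr0.
rewrite addrC mulVf // -exprMn mulVf // expr1n; exact: (nat2_neq0 F hF).
Qed.

Lemma orth_unit : (n < \dim {:V})%N -> exists2 u, orth u & form u u = 1.
Proof.
move=> /orth_anisotropic [u ou uu].
(* By conjugate symmetry [form u u] equals its own cube, and it is nonzero. *)
have : form u u ^+ 2 == 1.
  by apply/eqP/(mulfI uu); rewrite -exprS -formC mulr1.
rewrite sqrf_eq1 => /orP[/eqP u1 | /eqP u1]; first by exists u.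
have [zeta zP] := prim_root_exists F hF.
exists (zeta *: u) => [i ni|]; first by rewrite formZr ou // mulr0.
by rewrite formZr formZl u1 mulrA -exprS (zeta4 F hF) // mulrNN mulr1.
Qed.

End Extension.

(** The family is a total function on [nat], so an extension just overwrites the value at [n];
    values beyond the bound are arbitrary. *)
Lemma orthonormal_exists n : (n <= \dim {:V})%N ->
  exists e : nat -> V, forall i j, (i < n)%N -> (j < n)%N ->
    form (e i) (e j) = (i == j)%:R.
Proof.
elim: n => [|n IHn] nd; first by exists (fun=> 0).
have [e eP] := IHn (ltnW nd).
have [u ou uu] := orth_unit n e eP nd.
exists (fun i => if i == n then u else e i) => i j.
rewrite !ltnS (leq_eqVlt i) (leq_eqVlt j).
case: eqVneq => [-> _ | ni /= ltin]; case: eqVneq => [-> _ | nj /= ltjn].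
- by rewrite uu.
- by rewrite formC ou // expr0n.
- by rewrite ou // (negPf ni).
- exact: eP.
Qed.

End OrthonormalFamily.

(** * Transfer to an arbitrary unitary space *)

Lemma isometry_fspace (F : finFieldType) (hF : #|F| = (3 ^ 2)%N)
    (V : vectType F) (form : V -> V -> F) (m : nat) :
  unitary_form form -> (2 ^ m <= \dim {:V})%N ->
  exists f : fspace F m -> V,
    forall phi psi, form (f phi) (f psi) = fun_form phi psi.
Proof.
move=> fU md.
have [e eP] := orthonormal_exists F hF V form fU _ md.
have lt_rank (x : grp m) : (enum_rank x < 2 ^ m)%N.
  by rewrite -(card_grp m) ltn_ord.
(* The indicator of [x] goes to the orthonormal vector numbered by the rank of [x]. *)
exists (fun phi => \sum_x (phi x : F) *: e (enum_rank x)) => phi psi.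
rewrite (form_suml F hF V form fU); apply: eq_bigr => x _.
rewrite (formZl F V form fU); congr (_ * _).
rewrite (form_sumr F V form fU) -[RHS](sum_delta F m psi x).
apply: eq_bigr => z _; rewrite (formZr F V form fU) eP //; congr (_ * _%:R).
by rewrite (inj_eq val_inj) (inj_eq enum_rank_inj) eq_sym.
Qed.

Theorem theorem6p5 (F : finFieldType) (hF : #|F| = (3 ^ 2)%N) :
  (forall (m : nat) (zeta : F),
     (1 <= m)%N -> odd m -> (#|F|.-1).-primitive_root zeta ->
     unitary_form (V := fspace F m) (@fun_form F m) /\
     ETF (V := fspace F m) (@fun_form F m) 0 1 0 (gabor (fiducial m zeta))) /\
  (forall (k : nat) (V : vectType F) (form : V -> V -> F),
     unitary_form form -> \dim {:V} = (2 * 4 ^ k)%N ->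
     exists (a b : 'F_3) (Phi : 'I_((\dim {:V} ^ 2)%N) -> V),
       equiangular form a b Phi /\ a ^+ 2 <> b).
Proof.
split=> [m zeta _ m_odd zP | k V form fU dimV].
  by split; [exact: fun_form_unitary | exact: gabor_ETF].
(* Twice a power of 4 is exactly an odd power of 2. *)
pose m := (2 * k).+1.
have dimE : \dim {:V} = (2 ^ m)%N by rewrite dimV expnS expnM.
have m_odd : odd m by rewrite /m mul2n /= odd_double.
have [zeta zP] := prim_root_exists F hF.
have [diag off] := gabor_equiangular F hF m zeta m_odd zP.
have [|f fP] := isometry_fspace F hF V form m fU; first by rewrite dimE.
have cardE : (\dim {:V} ^ 2)%N = #|{: grp m * grp m}|.
  by rewrite card_prod card_grp dimE.
(* The [d ^ 2] indices enumerate the pairs of group elements bijectively, so distinct indices give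
   distinct pairs. *)
pose g (i : 'I_((\dim {:V} ^ 2)%N)) : grp m * grp m := enum_val (cast_ord cardE i).
exists 0, 1, (fun i => f (gabor (fiducial m zeta) (g i))); split=> //.
split=> [i | i j ij]; rewrite !fP //.
by apply: off => /enum_val_inj/cast_ord_inj.
Qed.
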